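(* Let $\Gamma$ and $\Gamma'$ be finite or infinite (locally finite) rooted trees, with $\Gamma$ spherically symmetric. Then $\Gamma$ dominates $\Gamma'$ if and only if for every $n \geq 1$ the $n$-th generation $\Gamma_n = \{v \in \Gamma : |v| = n\}$ of $\Gamma$ is at least as big as the $n$-th generation of $\Gamma'$, i.e. $|\Gamma_n| \geq |\Gamma'_n|$.
   Context: All trees are locally finite and rooted; the root of $\Gamma$ is $\rho$ and the root of $\Gamma'$ is $\rho'$. For a vertex $v$, $|v|$ denotes the graph distance from the root to $v$, and $w \leq v$ means that $w$ lies on the path from the root to $v$. A child of $v$ is a neighbor $w \ne v$ of $v$ with $v \leq w$. $\Gamma_n = \{v : |v| = n\}$ is the $n$-th generation (level) and $\Gamma_{|n}$ denotes the first $n$ levels of $\Gamma$, i.e. the subtree of vertices at distance at most $n$ from the root. $\Gamma$ is spherically symmetric with growth function $f$ if every vertex $v \in \Gamma$ has exactly $f(|v|+1)$ children, so the number of children depends only on the distance from the root. Given i.i.d. real random variables $\{X(v) : v \in \Gamma\}$ labelling the vertices, an integer $n \geq 1$ and a Borel set $B \subseteq \mathbb{R}^n$, $P(B; \Gamma_{|n})$ denotes the probability that there is a non-self-intersecting path $\rho, v_1, \ldots, v_n$ in $\Gamma$ starting at the root (so $|v_i| = i$) with $(X(v_1), \ldots, X(v_n)) \in B$. (If $\Gamma$ has no vertex at level $n$ this probability is $0$.) Domination: $\Gamma$ dominates $\Gamma'$ if whenever $\{X(v) : v \in \Gamma\} \cup \{X'(w) : w \in \Gamma'\}$ is a collection of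 i.i.d. real random variables (with any common law), $n \geq 1$ is an integer, and $B \subseteq \mathbb{R}^n$ is a Borel set, one has $P(B; \Gamma_{|n}) \geq P(B; \Gamma'_{|n})$, where the second probability is computed with the labels $X'$. *)

(* Defs.v *)
From HB Require Import structures.
From mathcomp Require Import all_boot all_order all_algebra.
From mathcomp Require Import all_classical all_reals all_analysis.

Set Implicit Arguments.
Unset Strict Implicit.
Unset Printing Implicit Defensive.

Local Open Scope classical_set_scope.
Local Open Scope card_scope.

(* A cycle has at least three vertices: a duplicate-free cyclic sequence of
   size 2 is a single edge traversed back and forth. *)
Record rooted_tree := RootedTree {
  vertex :> choiceType;
  adj : rel vertex;
  tree_root : vertex;
  adj_sym : symmetric adj;
  adj_irr : irreflexive adj;
  adj_connected : forall u v, exists2 p, path adj u p & last u p = v;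
  adj_acyclic : forall c : seq vertex, ucycle adj c -> size c <= 2;
  adj_locally_finite : forall v, finite_set [set w | adj v w]
}.

Arguments adj {_} _ _.
Arguments tree_root {_}.

Section Trees.
Variable G : rooted_tree.
Implicit Types (u v w : G) (n : nat).

Definition has_walk u v n :=
  `[< exists p, [/\ path adj u p, last u p = v & size p = n] >].

Lemma has_walk_ex u v : exists n, has_walk u v n.
Proof.
by have [p up pv] := adj_connected u v; exists (size p); apply/asboolP; exists p.
Qed.

Definition graph_dist u v : nat := ex_minn (has_walk_ex u v).

Definition depth v : nat := graph_dist tree_root v.

(* [w <= v] in the tree order *)
Definition ancestor w v :=
  exists p, [/\ path adj tree_root p, uniq (tree_root :: p),
                last tree_root p = v & w \in tree_root :: p].

Definition children v : set G := [set w | [/\ adj v w, w != v & ancestor v w]].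

Definition level n : set G := [set v | depth v = n].

Definition spherically_symmetric_with (f : nat -> nat) :=
  forall v, children v #= `I_(f (depth v).+1).

Definition spherically_symmetric := exists f, spherically_symmetric_with f.

End Trees.

Arguments level : clear implicits.
Arguments spherically_symmetric : clear implicits.
Arguments spherically_symmetric_with : clear implicits.

Section IID.
Context d (T : measurableType d) (R : realType) (P : probability T R).
Variables (I : choiceType) (X : I -> {RV P >-> R}).

Definition mutually_independent :=
  forall (s : seq I) (A : I -> set R), uniq s -> (forall i, measurable (A i)) ->
    (P (\bigcap_(i in [set` s]) (X i @^-1` A i)) =
     \prod_(i <- s) P (X i @^-1` A i))%E.

Definition identically_distributed :=
  forall (i j : I) (A : set R), measurable A ->
    distribution P (X i) A = distribution P (X j) A.

Definition iid := mutually_independent /\ identically_distributed.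

End IID.

Section Domination.
Context (R : realType).

(* The label of the root is not tested. *)
Definition path_event (G : rooted_tree) (T : Type) (X : G -> T -> R) (n : nat)
    (B : set (n.-tuple R)) : set T :=
  [set t | exists p : n.-tuple G,
     [/\ path adj tree_root p, uniq (tree_root :: p)
       & B [tuple X (tnth p i) t | i < n]]].

(* Measurability in [n.-tuple R] refers to the product of the Borel
   sigma-algebras of [R], i.e. the Borel sigma-algebra of R^n. *)
Definition dominates (G G' : rooted_tree) :=
  forall (d : measure_display) (T : measurableType d) (P : probability T R)
    (X : G -> {RV P >-> R}) (X' : G' -> {RV P >-> R}),
    iid (fun i : G + G' => match i with inl v => X v | inr w => X' w end) ->
  forall (n : nat) (B : set (n.-tuple R)), 1 <= n -> measurable B ->
    (P (path_event (fun w => X' w) B) <= P (path_event (fun v => X v) B))%E.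

End Domination.

(* Main.v *)
From HB Require Import structures.
Require Import Defs.
From mathcomp Require Import all_boot all_order all_algebra.
From mathcomp Require Import finmap.
From mathcomp Require Import all_classical all_reals all_analysis.
From mathcomp Require Import measurable_realfun ring lra.

(** The probability that no path of length [n] lies in [B] is, for a test [B]
    that only reads finitely many classes of labels, a finite recursion on the
    tree: a vertex misses [B] if and only if each of its children does, given the
    labels read so far, and distinct children depend on disjoint sets of labels.
    Give all the vertices of generation [d] the same past labels [s], let [q v s]
    be the probability that [v] misses [B] and [r s] the same quantity for a
    vertex of generation [d] of the symmetric tree, which has [N] such vertices.
    Then [r s ^ N <= \prod_v q v s]: going from generation [d + 1] to [d], this
    is Hoelder's inequality for at most [N'] factors with exponents [1 / N'],
    where [N'] is the size of generation [d + 1] of the symmetric tree. At [d = 0]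
    this is the domination inequality. A general Borel set [B] is approximated by
    such finitary tests, simultaneously for the laws of all the (finitely many)
    paths of length [n] in both trees.

    Conversely, for fair bits the event that some vertex of generation [n] has
    label [1] has probability [1 - 2 ^- |G_n|], which determines [|G_n|]. *)

Set Implicit Arguments.
Unset Strict Implicit.
Unset Printing Implicit Defensive.
Import Order.TTheory GRing.Theory Num.Theory.

Local Open Scope classical_set_scope.
Local Open Scope card_scope.

(** * Rooted trees *)

Section Graph.
Variable G : rooted_tree.
Implicit Types (u v w : G) (p q : seq G).
Local Notation root := (@tree_root G).

Lemma path_adj_rev u p :
  path adj u p -> path adj (last u p) (rev (belast u p)).
Proof.
by rewrite rev_path; apply: sub_path => x y; rewrite /= adj_sym.
Qed.

(** One path followed by the other reversed is a cycle on [size p + size q + 2] vertices, and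
    [adj_acyclic] allows at most two. *)
Lemma disjoint_paths_nil u z p q :
  path adj u (rcons p z) -> path adj u (rcons q z) ->
  uniq (u :: z :: p ++ q) -> p = [::] /\ q = [::].
Proof.
move=> pp /path_adj_rev; rewrite last_rcons belast_rcons => pq upq.
have : ucycle adj (u :: p ++ z :: rev q).
  apply/andP; split.
    rewrite /= -cat_rcons rcons_cat cat_path last_rcons pp.
    by rewrite -[rcons _ u]rev_cons.
  rewrite -(perm_uniq (_ : perm_eq (u :: z :: p ++ q) _)) //.
  by rewrite perm_cons perm_sym -cat1s perm_catCA /= perm_cons perm_cat2l perm_rev.
move=> /adj_acyclic; rewrite /= size_cat /= size_rev.
by case: p {pp pq upq} => [|? ?]; case: q => [|? ?] //=; rewrite ?addnS.
Qed.

(** Once common first edges are removed, suppose that the paths diverge. Cut the first one at its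
    first vertex [z] on the second: the two pieces up to [z] have disjoint interiors, so both are
    single edges and the paths agree on [z] after all. *)
Lemma simple_path_unique u p q :
  path adj u p -> uniq (u :: p) -> path adj u q -> uniq (u :: q) ->
  last u p = last u q -> p = q.
Proof.
elim: p u q => [|x p IH] u [|y q] //.
- by move=> _ _ _ + /= eq_u; rewrite eq_u /= mem_last.
- by move=> _ + _ _ /= eq_u; rewrite -eq_u /= mem_last.
have [->|neq_xy] := eqVneq x y.
  by move=> /= /andP[_ pp] /andP[_ up] /andP[_ pq] /andP[_ uq] /IH ->.
move=> pp up pq uq /= eq_last.
exfalso; move/eqP: neq_xy; apply.
have : has [in y :: q] (x :: p).
  by apply/hasP; exists (last x p); [exact: mem_last|rewrite eq_last /= mem_last].
have -> : x = head u (x :: p) by []. have -> : y = head u (y :: q) by [].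
move: pp up pq uq.
move: (x :: p) (y :: q) => P Q + + + + /split_find hPQ.
case: hPQ => z P1 P2 zQ; case/path.splitP: zQ => Q1 Q2 dis.
rewrite !cat_path => /andP[pp _] up /andP[pq _] uq.
move: up; rewrite cat_rcons /= mem_cat inE cat_uniq /= !negb_or.
case/andP=> /and3P[uP uz _] /and3P[uqP /andP[zP _] _].
move: uq; rewrite cat_rcons /= mem_cat inE cat_uniq /= !negb_or.
case/andP=> /and3P[uQ _ _] /and3P[uqQ /andP[zQ _] _].
suff upq : uniq (u :: z :: P1 ++ Q1).
  by have [-> ->] := disjoint_paths_nil pp pq upq.
rewrite !cons_uniq inE !mem_cat cat_uniq !negb_or uz uP uQ zP zQ uqP uqQ /= andbT.
apply: contra dis => /hasP[w wQ wP].
by apply/hasP; exists w => //=; rewrite mem_cat mem_rcons inE wQ orbT.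
Qed.

Lemma children_finite v : finite_set (children v).
Proof.
by apply: sub_finite_set (adj_locally_finite v) => w [].
Qed.

Definition kids v : seq G := enum_fset (fset_set (children v)).

Lemma kids_uniq v : uniq (kids v). Proof. exact: fset_uniq. Qed.

Lemma mem_kids v w : (w \in kids v) <-> children v w.
Proof.
split=> [|?]; first by rewrite in_fset_set ?inE//; exact: children_finite.
by rewrite in_fset_set ?inE//; exact: children_finite.
Qed.

Lemma size_kids v n : children v #= `I_n -> size (kids v) = n.
Proof. exact: card_fset_set. Qed.

Definition kid : rel G := fun v w => w \in kids v.

(** Lets descending [kid] steps replace simple paths from the root. From right to left, the simple
    path that witnesses [ancestor] starts with [p] by uniqueness, so the new vertex, which comes
    later on it, is not on [p]. *)
Lemma simple_path_kid p :
  (path adj root p && uniq (root :: p)) = path kid root p.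
Proof.
elim/last_ind: p => [//|p w IH].
rewrite !rcons_path /= rcons_uniq mem_rcons inE negb_or.
apply/idP/idP.
  case/andP=> /andP[pp aw] /andP[/andP[nw rp] /andP[wp up]].
  have sp : path adj root p && uniq (root :: p) by rewrite /= pp rp up.
  rewrite -IH sp /=; apply/mem_kids; split => //.
    apply: contraNneq wp => eqw.
    by move: (mem_last root p); rewrite -eqw inE eq_sym (negbTE nw).
  exists (rcons p w); split; first by rewrite rcons_path pp.
  - by rewrite /= mem_rcons inE negb_or nw rp rcons_uniq wp.
  - by rewrite last_rcons.
  - by rewrite -cats1 -cat_cons mem_cat mem_last.
case/andP=> + /mem_kids[aw nw [q [pq uq lq vq]]].
rewrite -IH => /andP[pp up].
case/path.splitPl: vq pq uq lq => q1 q2 eq_l.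
rewrite cat_path => /andP[pq1 pq2] uq.
have uq1 : uniq (root :: q1) by move: uq; rewrite -cat_cons cat_uniq => /andP[].
have eq_pq : p = q1 := simple_path_unique pp up pq1 uq1 (esym eq_l).
subst q1; rewrite last_cat => lq.
have wq2 : w \in q2.
  move: lq nw; case: (q2) => [/= ->|y r /= <-]; first by rewrite eqxx.
  by rewrite mem_last.
rewrite pp aw /=.
move: uq up; rewrite -cat_cons cat_uniq => /and3P[_ dis _].
move=> /andP[rp up]; apply/and3P; split=> //.
  rewrite rp andbT.
  by have := hasPn dis _ wq2; rewrite inE negb_or eq_sym => /andP[].
by have := hasPn dis _ wq2; rewrite inE negb_or => /andP[].
Qed.

Lemma kid_path_unique p q :
  path kid root p -> path kid root q -> last root p = last root q -> p = q.
Proof.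
by rewrite -!simple_path_kid => /andP[? ?] /andP[? ?]; exact: simple_path_unique.
Qed.

Lemma kid_path_ex v : exists2 p, path kid root p & last root p = v.
Proof.
have [p pp <-] := adj_connected root v.
case/shortenP: pp => p' pp' up' _.
by exists p' => //; rewrite -simple_path_kid pp'.
Qed.

(** A shortest walk can be shortened to a simple path, which is [p] by uniqueness. *)
Lemma depth_last p : path kid root p -> depth (last root p) = size p.
Proof.
rewrite /depth /graph_dist; case: ex_minnP => m /asboolP[q [+ + <-]] min_q pp.
case/shortenP => q' pq' uq' sub_q' eq_l.
have eq_pq : p = q' by apply: kid_path_unique => //; rewrite -simple_path_kid pq'.
move: pp; rewrite -simple_path_kid => /andP[pp _].
have hp : has_walk root (last root p) (size p) by apply/asboolP; exists p.
apply/eqP; rewrite eqn_leq (min_q _ hp) eq_pq uniq_leq_size //.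
by case/andP: uq'.
Qed.

Lemma depth_root : depth root = 0.
Proof. exact: (@depth_last [::]). Qed.

Lemma depth_kid v w : kid v w -> depth w = (depth v).+1.
Proof.
move=> vw; have [p pp lp] := kid_path_ex v.
have pw : path kid root (rcons p w) by rewrite rcons_path pp lp.
by rewrite -lp depth_last // -(last_rcons root p w) depth_last // size_rcons.
Qed.

Lemma kid_inj v v' w : kid v w -> kid v' w -> v = v'.
Proof.
have [p pp <-] := kid_path_ex v; have [p' pp' <-] := kid_path_ex v'.
move=> pw p'w; have : rcons p w = rcons p' w.
  by apply: kid_path_unique; rewrite ?rcons_path ?pp ?pp' ?last_rcons.
by move/rcons_inj => [->].
Qed.

Fixpoint generation n : seq G :=
  if n is n'.+1 then flatten [seq kids v | v <- generation n'] else [:: root].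

Lemma mem_generation n v : (v \in generation n) = (depth v == n).
Proof.
elim: n v => [|n IH] v /=.
  rewrite inE; apply/eqP/eqP => [->|]; first exact: depth_root.
  have [[|x p] pp <-] // := kid_path_ex v.
  by rewrite depth_last.
apply/flatten_mapP/eqP => [[u + uv]|].
  by rewrite IH (depth_kid uv) => /eqP ->.
have [p pp <-] := kid_path_ex v; rewrite depth_last //.
case/lastP: p pp => [//|p w]; rewrite size_rcons rcons_path => /andP[pp pw] [sp].
by exists (last root p); rewrite ?last_rcons // IH depth_last // sp.
Qed.

Lemma generation_uniq n : uniq (generation n).
Proof.
elim: n => [//|n] /=; elim: (generation n) => [//|v s IH] /= /andP[vs /IH us].
rewrite cat_uniq kids_uniq us andbT /=.
apply/hasPn => w /flatten_mapP[u us' uw]; apply: contra vs => vw.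
by rewrite (kid_inj vw uw).
Qed.

Lemma level_generation n : level G n = [set` generation n].
Proof.
by apply/seteqP; split=> v /=; rewrite /level /= mem_generation => /eqP.
Qed.

Lemma generation_paths n v :
  v \in generation n <-> exists p, [/\ path kid root p, size p = n & last root p = v].
Proof.
rewrite mem_generation; split=> [/eqP <-|[p [pp <- <-]]]; last by rewrite depth_last.
by have [p pp <-] := kid_path_ex v; exists p; rewrite depth_last.
Qed.

End Graph.

Lemma card_seq (T : choiceType) (s : seq T) :
  uniq s -> [set` s] #= `I_(size s).
Proof.
move=> us; have <- : [set` [fset x in s]%fset] = [set` s].
  by apply/seteqP; split => x /=; rewrite inE.
by apply/card_eq_fsetP; rewrite card_fseq undup_id.
Qed.

Lemma card_seq_le (T T' : choiceType) (s : seq T) (s' : seq T') :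
  uniq s -> uniq s' -> ([set` s] #<= [set` s']) = (size s <= size s').
Proof.
move=> /card_seq us /card_seq us'.
by rewrite (card_le_eql us) (card_le_eqr us') card_le_II.
Qed.

Local Open Scope ring_scope.

(** * The inequality for missing probabilities *)

(** Pads a product of at most [N] factors to exactly [N] with neutral ones. *)
Lemma big_nth_default (T A : Type) (idx : T) (op : Monoid.law idx) (d : A)
    (s : seq A) (F : A -> T) N : F d = idx -> (size s <= N)%N ->
  \big[op/idx]_(i < N) F (nth d s i) = \big[op/idx]_(x <- s) F x.
Proof.
move=> Fd; elim: s N => [|x s IH] [|N] //= sN.
- by rewrite big_ord0 big_nil.
- by rewrite big_nil big1 // => i _; rewrite nth_default.
- by rewrite big_ord_recl big_cons /= IH.
Qed.

Section Hoelder.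
Variables (R : realType) (K : finType) (p : K -> R).
Hypothesis p_ge0 : forall j, 0 <= p j.
Hypothesis p_sum1 : \sum_j p j = 1.

(** Generalized Hoelder inequality with all exponents [1 / N], raised to the power [N]. Dividing
    every factor by its mean reduces it to AM-GM at each point. *)
Lemma hoelder_ord N (Y : 'I_N -> K -> R) (Z : K -> R) :
  (forall i j, 0 <= Y i j) -> (forall j, 0 <= Z j) ->
  (forall j, Z j ^+ N <= \prod_i Y i j) ->
  (\sum_j p j * Z j) ^+ N <= \prod_i \sum_j p j * Y i j.
Proof.
move=> Y0 Z0 ZY.
case: N => [|N] in Y Y0 ZY *; first by rewrite big_ord0 expr0.
have e0 i : 0 <= \sum_j p j * Y i j by apply: sumr_ge0 => j _; rewrite mulr_ge0.
(* A factor of mean zero vanishes wherever [p] does not; then so does [Z], and the left side is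
   zero. *)
have [[i ei]|epos] := pselect (exists i, \sum_j p j * Y i j = 0).
  suff -> : \sum_j p j * Z j = 0 by rewrite expr0n prodr_ge0.
  apply: big1 => j _.
  have /eqP := psumr_eq0P (fun j _ => mulr_ge0 (p_ge0 j) (Y0 i j)) ei (i := j) isT.
  rewrite mulf_eq0 => /orP[/eqP->|/eqP Yij]; first by rewrite mul0r.
  have := ZY j; rewrite (bigD1 i) //= Yij mul0r => Zj.
  have : Z j ^+ N.+1 == 0 by rewrite eq_le Zj exprn_ge0.
  by rewrite expf_eq0 => /andP[_ /eqP ->]; rewrite mulr0.
have {}epos i : 0 < \sum_j p j * Y i j.
  by rewrite lt0r e0 andbT; apply/eqP => ei; apply: epos; exists i.
set e := fun i => \sum_j p j * Y i j.
have prod_e_gt0 : 0 < \prod_i e i by apply: prodr_gt0 => i _; exact: epos.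
(* The geometric mean of the means, by which [Z] is normalized. *)
pose g := (\prod_i e i) `^ (N.+1%:R^-1).
have g0 : 0 < g by exact: powR_gt0.
have gN : g ^+ N.+1 = \prod_i e i.
  by rewrite -powR_mulrn ?ltW // -powRrM mulVf ?pnatr_eq0 // powRr1 // ltW.
(* AM-GM, applied to the normalized factors [Y i j / e i], of [p]-mean [1]. *)
have mean j : Z j / g <= \sum_i (Y i j / e i) / N.+1%:R.
  have Zg : 0 <= Z j / g by rewrite divr_ge0 // ltW.
  have S0 : 0 <= \sum_i (Y i j / e i) / N.+1%:R.
    by apply: sumr_ge0 => i _; rewrite !divr_ge0 // ltW // epos.
  rewrite -(@ler_pXn2r _ N.+1) //.
  have := @leif_AGM _ 'I_N.+1 predT (fun i => Y i j / e i).
  rewrite cardT size_enum_ord; case=> [i _|+ _].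
    by rewrite divr_ge0 // ltW // epos.
  rewrite -mulr_suml; apply: le_trans.
  rewrite expr_div_n gN prodf_div ler_pM2r ?invr_gt0 //.
have EZ0 : 0 <= \sum_j p j * Z j by apply: sumr_ge0 => j _; rewrite mulr_ge0.
rewrite -/e -gN lerXn2r ?nnegrE ?(ltW g0) //.
rewrite -[leRHS]mul1r -ler_pdivrMr // mulr_suml.
apply: (@le_trans _ _ (\sum_j p j * \sum_i (Y i j / e i) / N.+1%:R)).
  by apply: ler_sum => j _; rewrite -mulrA ler_wpM2l.
rewrite (eq_bigr (fun j => \sum_i (p j * Y i j) / e i / N.+1%:R)); last first.
  by move=> j _; rewrite mulr_sumr; apply: eq_bigr => i _; rewrite !mulrA.
rewrite exchange_big /= (eq_bigr (fun=> N.+1%:R^-1)); last first.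
  by move=> i _; rewrite -!mulr_suml divff ?mul1r // gt_eqF // epos.
by rewrite sumr_const card_ord -[_ *+ _]mulr_natl divff // pnatr_eq0.
Qed.

(** The missing factors are taken constant equal to 1; their mean is 1 because [p] sums to 1. *)
Lemma hoelder_seq N (I : Type) (s : seq I) (Y : I -> K -> R) (Z : K -> R) :
  (size s <= N)%N ->
  (forall i j, 0 <= Y i j) -> (forall j, 0 <= Z j) ->
  (forall j, Z j ^+ N <= \prod_(i <- s) Y i j) ->
  (\sum_j p j * Z j) ^+ N <= \prod_(i <- s) \sum_j p j * Y i j.
Proof.
move=> sN Y0 Z0 ZY.
pose Yo (o : option I) j := if o is Some i then Y i j else 1.
have := @hoelder_ord N (fun i => Yo (nth None (map Some s) i)) Z.
rewrite (@big_nth_default _ _ _ _ None (map Some s) (fun o => \sum_j p j * Yo o j)).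
- rewrite big_map; apply=> //.
    by move=> i j; rewrite /Yo; case: nth.
  move=> j; rewrite (@big_nth_default _ _ _ _ None (map Some s) (Yo ^~ j)) ?size_map //.
  by rewrite big_map.
- by rewrite -[RHS]p_sum1; apply: eq_bigr => j _; rewrite mulr1.
- by rewrite size_map.
Qed.

Variable D : seq K -> bool.

(* Probability that no descending path of [k] edges from [v] completes the word
   [s] of labels already read to a word satisfying [D]. *)
Fixpoint miss (G : rooted_tree) k (v : G) s : R :=
  if k is k'.+1 then \prod_(w <- kids v) \sum_j p j * miss k' w (rcons s j)
  else (~~ D s)%:R.

(* The value of [miss] at a vertex of depth [d] of the symmetric tree, see
   [miss_spherical]. *)
Fixpoint sphere_miss (f : nat -> nat) k d s : R :=
  if k is k'.+1
  then (\sum_j p j * sphere_miss f k' d.+1 (rcons s j)) ^+ f d.+1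
  else (~~ D s)%:R.

Lemma miss_ge0 (G : rooted_tree) k (v : G) s : 0 <= miss k v s.
Proof.
elim: k v s => [|k IH] v s /=; first exact: ler0n.
by apply: prodr_ge0 => w _; apply: sumr_ge0 => j _; rewrite mulr_ge0.
Qed.

Lemma sphere_miss_ge0 f k d s : 0 <= sphere_miss f k d s.
Proof.
elim: k d s => [|k IH] d s /=; first exact: ler0n.
by apply: exprn_ge0; apply: sumr_ge0 => j _; rewrite mulr_ge0.
Qed.

Lemma miss_spherical (G : rooted_tree) f k (v : G) s :
  spherically_symmetric_with G f -> miss k v s = sphere_miss f k (depth v) s.
Proof.
move=> symG; elim: k v s => [//|k IH] v s /=.
rewrite big_seq (eq_bigr (fun=>
   \sum_j p j * sphere_miss f k (depth v).+1 (rcons s j))); last first.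
  by move=> w vw; apply: eq_bigr => j _; rewrite IH (depth_kid vw).
by rewrite -big_seq big_const_seq count_predT iter_mulr_1 (size_kids (symG v)).
Qed.

Lemma size_generation_spherical (G : rooted_tree) f d :
  spherically_symmetric_with G f ->
  size (generation G d.+1) = (size (generation G d) * f d.+1)%N.
Proof.
move=> symG /=; rewrite size_flatten /shape -map_comp sumnE big_map.
rewrite big_seq (eq_bigr (fun=> f d.+1)); last first.
  by move=> v; rewrite mem_generation => /eqP <- /=; exact: size_kids.
by rewrite -big_seq big_const_seq count_predT iter_addn addn0 mulnC.
Qed.

Lemma miss_generation (G G' : rooted_tree) f k d s :
  spherically_symmetric_with G f ->
  (forall n, size (generation G' n) <= size (generation G n))%N ->
  sphere_miss f k d s ^+ size (generation G d) <=
    \prod_(v <- generation G' d) miss k v s.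
Proof.
move=> symG le_gen; elim: k d s => [|k IH] d s /=.
  rewrite big_const_seq count_predT iter_mulr_1.
  (* All factors are the same number in [0, 1], whose powers decrease with the exponent. *)
  by rewrite ler_wiXn2l // ?ler0n // lern1 leq_b1.
(* The products over children merge into one product over generation [d.+1] of [G']; on the side of
   [G] the exponents multiply to the size of generation [d.+1]. *)
rewrite -(big_map (@kids G') xpredT
  (fun t => \prod_(w <- t) \sum_j p j * miss k w (rcons s j))).
rewrite -big_flatten /= -[flatten _]/(generation G' d.+1).
rewrite -exprM mulnC -size_generation_spherical //.
by apply: hoelder_seq => // *; [exact: miss_ge0|exact: sphere_miss_ge0].
Qed.

Lemma miss_root (G G' : rooted_tree) n :
  spherically_symmetric G ->
  (forall n, size (generation G' n) <= size (generation G n))%N ->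
  miss n (@tree_root G) [::] <= miss n (@tree_root G') [::].
Proof.
move=> [f symG] le_gen.
have := miss_generation n 0 [::] symG le_gen.
by rewrite /= big_seq1 expr1 (miss_spherical _ _ _ symG) depth_root.
Qed.

End Hoelder.

(** * Decision trees on independent labels *)

Lemma measure_partition d (T : measurableType d) (R : realType)
    (mu : {measure set T -> \bar R}) (K : finType) (g : T -> K) (E : set T) :
  measurable E -> (forall j, measurable (g @^-1` [set j])) ->
  mu E = (\sum_j mu (E `&` g @^-1` [set j]))%E.
Proof.
move=> mE mg.
have {1}-> : E = \bigcup_(j in [set` index_enum K]) (E `&` g @^-1` [set j]).
  apply/seteqP; split=> [t Et|t [j _ []]//].
  by exists (g t) => //=; exact: mem_index_enum.
rewrite measure_fin_bigcup //; first 1 last.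
- by move=> i j _ _ [t [[_ /= <-] [_ /= <-]]].
- by move=> j _; exact: measurableI.
by rewrite -fsbig_seq // index_enum_uniq.
Qed.

(** Events are represented by finite adaptive tests, so that independence can be exploited by
    structural induction, one label at a time. *)
Inductive dtree (I K : Type) :=
  | Leaf of bool
  | Query of I & (K -> dtree I K).
Arguments Leaf {I K}.

Section DecisionTree.
Variables (I : choiceType) (K : finType).
Implicit Types (D : dtree I K) (V : set I) (x : I -> K).

Fixpoint dt_eval x D : bool :=
  match D with Leaf b => b | Query i f => dt_eval x (f (x i)) end.

Fixpoint dt_and D D' : dtree I K :=
  match D with
  | Leaf b => if b then D' else Leaf false
  | Query i f => Query i (fun j => dt_and (f j) D')
  end.

(* No branch queries a label twice, so that the successive answers are
   independent; [V] contains the labels that may still be queried. *)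
Fixpoint read_once V D : Prop :=
  match D with
  | Leaf _ => True
  | Query i f => V i /\ forall j, read_once (V `\ i) (f j)
  end.

Fixpoint dt_prob (R : pzRingType) (p : K -> R) D : R :=
  match D with
  | Leaf b => b%:R
  | Query i f => \sum_j p j * dt_prob p (f j)
  end.

Lemma dt_eval_and x D D' : dt_eval x (dt_and D D') = dt_eval x D && dt_eval x D'.
Proof. by elim: D => [[]|i f IH] //=. Qed.

(** Purely formal: [dt_prob] treats every query as a fresh answer, so disjointness of the queried
    labels matters only in [probability_dt]. *)
Lemma dt_prob_and (R : pzRingType) (p : K -> R) D D' :
  dt_prob p (dt_and D D') = dt_prob p D * dt_prob p D'.
Proof.
elim: D => [[]|i f IH] /=; rewrite ?mul1r ?mul0r // mulr_suml.
by apply: eq_bigr => j _; rewrite IH mulrA.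
Qed.

Lemma read_onceS V V' D : V `<=` V' -> read_once V D -> read_once V' D.
Proof.
elim: D V V' => [//|i f IH] V V' sV /= [Vi rf]; split; first exact: sV.
by move=> j; apply: IH (rf j) => k [Vk ki]; split=> //; exact: sV.
Qed.

Lemma read_once_and V V' D D' : V `&` V' `<=` set0 ->
  read_once V D -> read_once V' D' -> read_once (V `|` V') (dt_and D D').
Proof.
elim: D V => [b|i f IH] V dis /=.
  by move=> _ rD'; case: b => //=; apply: read_onceS rD'.
move=> [Vi rf] rD'; split; first by left.
move=> j; apply: read_onceS (IH j (V `\ i) _ (rf j) rD').
  move=> k [[Vk ki]|V'k]; split; [by left|by []|by right|].
  by move=> /= eki; apply: (dis i); split=> //; rewrite -eki.
by move=> k [[Vk _] V'k]; apply: (dis k).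
Qed.

Definition dt_all : seq (dtree I K) -> dtree I K :=
  foldr (@dt_and) (Leaf true).

Lemma dt_eval_all x Ds : dt_eval x (dt_all Ds) = all (dt_eval x) Ds.
Proof.
by elim: Ds => [//|D Ds IH]; rewrite [dt_all _]/(dt_and _ _) dt_eval_and IH.
Qed.

Lemma dt_prob_all (R : pzRingType) (p : K -> R) Ds :
  dt_prob p (dt_all Ds) = \prod_(D <- Ds) dt_prob p D.
Proof.
elim: Ds => [|D Ds IH]; first by rewrite big_nil.
by rewrite [dt_all _]/(dt_and _ _) dt_prob_and IH big_cons.
Qed.

Lemma read_once_all (J : choiceType) (js : seq J) (V : J -> set I)
    (F : J -> dtree I K) :
  uniq js -> (forall j, j \in js -> read_once (V j) (F j)) ->
  trivIset [set` js] V ->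
  read_once (\bigcup_(j in [set` js]) V j) (dt_all (map F js)).
Proof.
move=> ujs rF triv; elim: js => [//|j js IH] in ujs rF triv *.
have /andP[njs {}ujs] := ujs.
rewrite -[dt_all _]/(dt_and (F j) (dt_all (map F js))).
apply: (@read_onceS (V j `|` \bigcup_(k in [set` js]) V k)).
  move=> i [Vji|[k /= ks Vki]]; first by exists j; rewrite //= mem_head.
  by exists k; rewrite //= inE ks orbT.
apply: read_once_and.
- move=> i [Vji [k /= ks Vki]].
  have /= := triv j k (mem_head _ _); rewrite inE ks orbT => /(_ isT).
  by move=> ejk; move: njs; rewrite ejk ?ks //; exists i.
- by apply: rF; rewrite mem_head.
- apply: IH => // [k ks|]; first by apply: rF; rewrite inE ks orbT.
  by apply: sub_trivIset triv => k /= ks; rewrite inE ks orbT.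
Qed.

End DecisionTree.

Section Independent.
Context d (T : measurableType d) (R : realType) (P : probability T R).
Variables (I : choiceType) (X : I -> {RV P >-> R}) (K : finType) (c : R -> K).
Hypothesis indepX : mutually_independent X.
Hypothesis mc : forall j, measurable (c @^-1` [set j]).
Variable p : K -> R.
Hypothesis lawX : forall i j, P (X i @^-1` (c @^-1` [set j])) = (p j)%:E.

Let codes (t : T) (i : I) : K := c (X i t).

Lemma measurable_code i j : measurable ((codes ^~ i) @^-1` [set j]).
Proof. exact: (measurable_funPTI (X i) (mc j)). Qed.

Lemma measurable_dt (D : dtree I K) : measurable [set t | dt_eval (codes t) D].
Proof.
elim: D => [b|i f IH] /=.
  by case: b; [rewrite (_ : [set _ | _] = setT)|rewrite (_ : [set _ | _] = set0)];
     rewrite ?predeqE.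
rewrite (_ : [set _ | _] = \bigcup_(j in [set` index_enum K])
  ((codes ^~ i) @^-1` [set j] `&` [set t | dt_eval (codes t) (f j)])).
  apply: fin_bigcup_measurable => // j _; apply: measurableI => //.
  exact: measurable_code.
apply/seteqP; split=> t /=.
  by move=> ft; exists (codes t i) => //=; exact: mem_index_enum.
by move=> [j _ [/= <-]].
Qed.

(** Strengthens [probability_dt] for the induction: [s] lists the labels already read and [a] their
    answers. A query moves its label from [V] to [s]; at a leaf, mutual independence gives the
    product. *)
Lemma dt_prob_indep (s : seq I) (a : I -> K) (V : set I) (D : dtree I K) :
  uniq s -> (forall i, i \in s -> ~ V i) -> read_once V D ->
  P ([set t | dt_eval (codes t) D] `&`
     \bigcap_(i in [set` s]) (X i @^-1` (c @^-1` [set a i]))) =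
  (dt_prob p D * \prod_(i <- s) p (a i))%:E.
Proof.
elim: D s a V => [b|i f IH] s a V us sV /= rD.
  case: b.
    rewrite (_ : [set _ | _] = setT) ?predeqE // setTI mul1r.
    rewrite (@indepX s (fun i => c @^-1` [set a i])) //.
    by rewrite -prodEFin; apply: eq_bigr => i _; exact: lawX.
  rewrite (_ : [set _ | _] = set0) ?set0I ?measure0 ?mul0r // predeqE.
  by [].
case: rD => Vi rf.
have nis : i \notin s by apply/negP => /sV.
rewrite (measure_partition P (g := codes ^~ i)); last first.
- exact: measurable_code.
- apply: measurableI; first exact: (measurable_dt (Query i f)).
  by apply: fin_bigcap_measurable => // k _; exact: (measurable_funPTI (X k)).
rewrite mulr_suml -sumEFin; apply: eq_bigr => j _.
(* The recorded answers, extended by the answer [j] at the new label [i]. *)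
pose a' k := if k == i then j else a k.
transitivity (P ([set t | dt_eval (codes t) (f j)] `&`
   \bigcap_(k in [set` i :: s]) (X k @^-1` (c @^-1` [set a' k])))).
  congr (P _); apply/seteqP; split=> t /=.
    move=> [[fj st] cj]; split; first by rewrite -cj.
    move=> k /=; rewrite inE /a'; case: eqVneq => [-> _//|_ /= ks].
    exact: st.
  move=> [fj st]; have cj : c (X i t) = j.
    by have := st i; rewrite /a' /= eqxx; apply; rewrite inE eqxx.
  split; last exact: cj.
  split; first by rewrite /codes cj.
  move=> k /= ks; have := st k; rewrite /a' /= inE ks orbT => /(_ isT).
  by rewrite ifN //; apply: contraNneq nis => <-.
rewrite (IH j (i :: s) a' (V `\ i)) //=; first 1 last.
- by rewrite nis.
- by move=> k; rewrite inE => /orP[/eqP->[]//|/sV nV [/nV]].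
congr (_%:E); rewrite big_cons {1}/a' eqxx mulrCA mulrA; congr (_ * _).
rewrite !big_seq; apply: eq_bigr => k ks; rewrite /a' ifN //.
by apply: contraNneq nis => <-.
Qed.

Lemma probability_dt (V : set I) (D : dtree I K) :
  read_once V D -> P [set t | dt_eval (codes t) D] = (dt_prob p D)%:E.
Proof.
move=> rD.
(* No label has been read yet; [c 0] is a default answer. *)
have := @dt_prob_indep [::] (fun=> c 0) V _ isT _ rD.
rewrite big_nil mulr1 => <- //; congr (P _).
by rewrite (_ : [set` [::]] = set0) ?bigcap_set0 ?setIT // predeqE.
Qed.

End Independent.

Section MissTree.
Variables (G : rooted_tree) (I : choiceType) (e : G -> I) (K : finType).
Hypothesis inj_e : injective e.
Variable D : seq K -> bool.
Implicit Types (v w : G).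

(** Contains [v] itself, through the empty path. *)
Definition descendants v : set G :=
  [set w | exists2 p, path (@kid G) v p & last v p = w].

(* Decides whether the event measured by [miss] occurs, reading only the labels
   of strict descendants of [v]. *)
Fixpoint miss_tree k v (s : seq K) : dtree I K :=
  if k is k'.+1
  then dt_all [seq Query (e w) (fun j => miss_tree k' w (rcons s j)) | w <- kids v]
  else Leaf (~~ D s).

Lemma dt_prob_miss_tree (R : realType) (p : K -> R) k v s :
  dt_prob p (miss_tree k v s) = miss p D k v s.
Proof.
elim: k v s => [//|k IH] v s /=.
rewrite dt_prob_all big_map; apply: eq_bigr => w _ /=.
by under eq_bigr do rewrite IH.
Qed.

Lemma dt_eval_miss_tree (x : I -> K) k v s :
  dt_eval x (miss_tree k v s) <->
  forall p, path (@kid G) v p -> size p = k -> ~~ D (s ++ map (x \o e) p).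
Proof.
elim: k v s => [|k IH] v s /=.
  split=> [Ds [|//] _ _|/(_ [::] isT erefl)]; by rewrite cats0.
rewrite dt_eval_all all_map.
split=> [/allP Dv [//|w p] /= /andP[vw pp] [sp]|Dv].
  by have /= := Dv w vw; rewrite IH => /(_ p pp sp); rewrite cat_rcons.
apply/allP => w vw; apply/IH => p pp sp; rewrite cat_rcons.
by apply: (Dv (w :: p)); rewrite /= ?pp ?sp ?andbT.
Qed.

Lemma depth_kid_path v p :
  path (@kid G) v p -> depth (last v p) = (depth v + size p)%N.
Proof.
elim: p v => [|w p IH] v /=; first by rewrite addn0.
by move=> /andP[vw /IH ->]; rewrite (depth_kid vw) addSnnS.
Qed.

(** Equal depths force equal lengths; then climb from the common end through unique parents. *)
Lemma kid_path_start v w p q :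
  path (@kid G) v p -> path (@kid G) w q -> last v p = last w q ->
  depth v = depth w -> v = w.
Proof.
move=> pp pq eql eqd.
have : size p = size q.
  apply: (@addnI (depth v)); rewrite -depth_kid_path // eql eqd.
  exact: depth_kid_path.
elim/last_ind: p q pp pq eql {eqd} => [|p x IH] q; case/lastP: q => [|q y] //.
- by move=> _ _ _; rewrite size_rcons.
- by move=> _ _ _; rewrite size_rcons.
rewrite !rcons_path !last_rcons !size_rcons => /andP[pp px] /andP[pq qy] exy [].
by rewrite exy in px; exact: IH pp pq (kid_inj px qy).
Qed.

(** Distinct children have disjoint sets of descendants, and below a child [w] its own label is read
    first, followed only by those of its strict descendants. *)
Lemma read_once_miss_tree k v s :
  read_once [set e w | w in descendants v `\ v] (miss_tree k v s).
Proof.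
elim: k v s => [//|k IH] v s /=.
apply: (@read_onceS _ _ [set i | exists2 w, w \in kids v & (e @` descendants w) i]).
  move=> i [w vw [u [p pp <-] <-]]; exists (last v (w :: p)) => //.
  split; first by exists (w :: p) => //=; rewrite pp andbT.
  move=> /= eqv; have := @depth_kid_path v (w :: p).
  by rewrite /= pp andbT eqv => /(_ vw) /eqP; rewrite -[X in X == _]addn0 eqn_add2l.
apply: read_onceS (read_once_all (V := fun w => e @` descendants w) (kids_uniq v) _ _).
- by move=> i [w /= vw wi]; exists w.
- move=> w vw /=; split; first by exists w => //; exists [::].
  move=> j; apply: read_onceS (IH w (rcons s j)) => i [u [wu nuw] <-].
  by split; [exists u|move=> /= /inj_e].
- move=> w w' /= vw vw' [i [[u [p pp pu] <-] [u' [p' pp' pu'] /inj_e eu]]].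
  apply: kid_path_start pp pp' _ _; first by rewrite pu pu' eu.
  by rewrite (depth_kid vw) (depth_kid vw').
Qed.

End MissTree.

(** * Approximation by cylinders *)

Section Approximation.
Context d (T : measurableType d) (R : realType) (mu : {measure set T -> \bar R}).
Hypothesis mu_fin : (mu setT < +oo)%E.
Variable Alg : set (set T).
Hypothesis mAlg : Alg `<=` measurable.
Hypothesis Alg0 : Alg set0.
Hypothesis AlgC : setC_closed Alg.
Hypothesis AlgU : setU_closed Alg.

Definition approximable (B : set T) :=
  measurable B /\
  forall eps : R, 0 < eps -> exists2 C, Alg C & (mu (B `+` C) < eps%:E)%E.

Lemma measurableY (B C : set T) :
  measurable B -> measurable C -> measurable (B `+` C).
Proof. by move=> mB mC; rewrite setY_def; apply: measurableU; apply: measurableD. Qed.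

Lemma setYCC (B C : set T) : ~` B `+` ~` C = B `+` C.
Proof. by rewrite !setY_def !setDE !setCK setUC; congr (_ `|` _); exact: setIC. Qed.

Lemma approximable_Alg B : Alg B -> approximable B.
Proof.
move=> AB; split; first exact: mAlg.
by move=> eps e0; exists B => //; rewrite setYK measure0 lte_fin.
Qed.

Lemma approximableC B : approximable B -> approximable (~` B).
Proof.
move=> [mB aB]; split; first exact: measurableC.
move=> eps /aB[C AC BC]; exists (~` C); first exact: AlgC.
by rewrite setYCC.
Qed.

Lemma approximableU B B' : approximable B -> approximable B' ->
  approximable (B `|` B').
Proof.
move=> [mB aB] [mB' aB']; split; first exact: measurableU.
move=> eps e0; have e2 : 0 < eps / 2 by rewrite divr_gt0.
have [C AC BC] := aB _ e2; have [C' AC' BC'] := aB' _ e2.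
exists (C `|` C'); first exact: AlgU.
have mY := measurableY mB (mAlg AC); have mY' := measurableY mB' (mAlg AC').
apply: (@le_lt_trans _ _ (mu ((B `+` C) `|` (B' `+` C')))).
  apply: le_measure; rewrite ?inE; [|exact: measurableU|].
    by apply: measurableY; apply: measurableU => //; exact: mAlg.
  rewrite !setY_def => t [[[Bt|Bt] /not_orP[nC nC']]|[[Ct|Ct] /not_orP[nC nC']]].
  - by left; left. - by right; left. - by left; right. - by right; right.
apply: le_lt_trans (measureU2 _ mY mY') _.
by rewrite [eps]splitr EFinD; exact: lteD.
Qed.

(** As [mu] is finite, some finite partial union is within [eps / 2] of the whole union; it is in
    turn approximated within [eps / 2]. *)
Lemma approximable_bigcup (F : (set T)^nat) :
  (forall k, approximable (F k)) -> approximable (\bigcup_k F k).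
Proof.
move=> aF; have mU : measurable (\bigcup_k F k).
  by apply: bigcup_measurable => k _; have [] := aF k.
split=> // eps e0; have e2 : 0 < eps / 2 by rewrite divr_gt0.
pose U N := \big[setU/set0]_(k < N) F k.
have aU N : approximable (U N).
  rewrite /U; elim: N => [|N IH]; first by rewrite big_ord0; exact: approximable_Alg.
  by rewrite big_ord_recr; exact: approximableU.
have mUN N : measurable (U N) by have [] := aU N.
have cvg0 : mu \o (fun N => \bigcup_k F k `\` U N) @ \oo --> 0%E.
  have cap0 : \bigcap_N (\bigcup_k F k `\` U N) = set0.
    apply/seteqP; split=> // t tN; have [[k _ Fkt] _] := tN 0%N I.
    have [_] := tN k.+1 I; apply; rewrite /U big_ord_recr /=; right; exact: Fkt.
  rewrite -(measure0 mu) -cap0; apply: nonincreasing_cvg_mu.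
  - apply: le_lt_trans mu_fin; apply: le_measure; rewrite ?inE //.
    exact: measurableD.
  - by move=> N; exact: measurableD.
  - by rewrite cap0.
  - move=> N M NM; apply/subsetPset; apply: setDS.
    by rewrite /U; exact: subset_bigsetU.
have [N muN] : exists N, (mu (\bigcup_k F k `\` U N) < (eps / 2)%:E)%E.
  have e2' : (0 < (eps / 2)%:E)%E by rewrite lte_fin.
  have [N _ HN] := cvg0 _ (open_ereal_lt' e2'); exists N.
  exact: (HN N (leqnn N)).
have [C AC UC] := (aU N).2 _ e2; exists C => //.
have mC := mAlg AC.
apply: (@le_lt_trans _ _ (mu ((\bigcup_k F k `\` U N) `|` (U N `+` C)))).
  apply: le_measure; rewrite ?inE; [exact: measurableY|apply: measurableU|].
  - exact: measurableD.
  - exact: measurableY.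
  rewrite !setY_def => t [[Ut nC]|[Ct nU]].
    by have [UNt|UNt] := pselect (U N t); [right; left|left].
  right; right; split=> // UNt; apply: nU; move: t UNt {Ct}.
  exact: bigsetU_bigcup.
have mD : measurable (\bigcup_k F k `\` U N) by exact: measurableD.
apply: le_lt_trans (measureU2 _ mD (measurableY (mUN N) mC)) _.
by rewrite [eps]splitr EFinD; exact: lteD.
Qed.

(** The approximable sets contain [Alg] and form a sigma-algebra. *)
Lemma sigma_approximable B : <<s Alg >> B -> approximable B.
Proof.
apply; split; last by move=> A; exact: approximable_Alg.
split; first exact: approximable_Alg.
- by move=> A; rewrite setTD; exact: approximableC.
- exact: approximable_bigcup.
Qed.

End Approximation.

Section Cylinder.
Variables (R : realType) (n : nat).

(** One finite coding [c] serves all coordinates and [D] reads words, as in [miss]; two different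
    codings are merged by their product. *)
Definition cylinder : set (set (n.-tuple R)) :=
  [set B | exists (K : finType) (c : R -> K) (D : seq K -> bool),
     (forall j, measurable (c @^-1` [set j])) /\ B = [set x : n.-tuple R | D (map c x)]].

Lemma cylinder_measurable : cylinder `<=` measurable.
Proof.
move=> _ [K [c [D [mc ->]]]].
rewrite (_ : [set _ | _] = \bigcup_(y in [set y : n.-tuple K | D y])
   \bigcap_(i in [set: 'I_n]) ((@tnth _ R ^~ i) @^-1` (c @^-1` [set tnth y i]))).
  apply: fin_bigcup_measurable => // y _; apply: fin_bigcap_measurable => // i _.
  by rewrite -[X in measurable X]setTI; exact: measurable_tnth.
apply/seteqP; split=> x /=.
  by move=> Dx; exists (map_tuple c x) => // i _ /=; rewrite tnth_map.
move=> [y Dy yx]; suff -> : map c x = y by [].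
have -> : y = map_tuple c x by apply: eq_from_tnth => i; rewrite tnth_map -(yx i).
by [].
Qed.

Lemma cylinder0 : cylinder set0.
Proof.
exists unit, (fun=> tt), (fun=> false); split; last by apply/seteqP; split.
by move=> []; rewrite (_ : _ @^-1` _ = setT) // predeqE => x; split.
Qed.

Lemma cylinderC : setC_closed cylinder.
Proof.
move=> _ [K [c [D [mc ->]]]]; exists K, c, (fun s => ~~ D s); split=> //.
by apply/seteqP; split=> x /= /negP.
Qed.

Lemma cylinderU : setU_closed cylinder.
Proof.
move=> _ _ [K [c [D [mc ->]]]] [K' [c' [D' [mc' ->]]]].
exists (K * K')%type, (fun x => (c x, c' x)),
  (fun s => D (map fst s) || D' (map snd s)); split.
  move=> [j j']; rewrite (_ : _ @^-1` _ = c @^-1` [set j] `&` c' @^-1` [set j']).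
    exact: measurableI.
  by apply/seteqP; split=> x /= [-> ->].
by apply/seteqP; split=> x /=; rewrite -!map_comp => /orP.
Qed.

(** A generator constrains one coordinate to a Borel set [A]; it is a cylinder for the two-valued
    coding by membership in [A]. *)
Lemma measurable_sigma_cylinder (B : set (n.-tuple R)) :
  measurable B -> <<s cylinder >> B.
Proof.
apply: sub_sigma_algebra2 => {}B; rewrite -bigcup_seq => -[i _ [A mA <-]].
exists bool, (fun x => x \in A), (fun s => nth false s i); split.
  move=> [].
    rewrite (_ : _ @^-1` _ = A) //.
    by apply/seteqP; split=> x /=; [exact: set_mem|exact: mem_set].
  rewrite (_ : _ @^-1` _ = ~` A); first exact: measurableC.
  apply/seteqP; split=> x /=; first by move/negbT; rewrite notin_setE.
  by move=> nA; apply/negbTE; rewrite notin_setE.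
rewrite setTI; apply/seteqP; split=> x /=;
  by rewrite (nth_map (tnth x i)) ?size_tuple // -tnth_nth inE.
Qed.

Lemma cylinder_approx (mu : {measure set (n.-tuple R) -> \bar R})
    (B : set (n.-tuple R)) (eps : R) :
  (mu setT < +oo)%E -> measurable B -> 0 < eps ->
  exists2 C, cylinder C & (mu (B `+` C) < eps%:E)%E.
Proof.
move=> mufin mB e0.
have [_] := sigma_approximable mufin cylinder_measurable cylinder0 cylinderC
  cylinderU (measurable_sigma_cylinder mB).
exact.
Qed.

End Cylinder.

(** * Path events: measurability, union bound, cylinder tests *)

Section PathEvent.
Context (G : rooted_tree) (R : realType) (n : nat).
Local Notation root := (@tree_root G).

Definition kid_paths : set (n.-tuple G) := [set p | path (@kid G) root p].

Lemma finite_kid_paths : finite_set kid_paths.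
Proof.
have inj : {in kid_paths &, injective (fun p : n.-tuple G => last root p)}.
  move=> p q /set_mem pp /set_mem pq epq; apply: val_inj.
  exact: kid_path_unique.
rewrite -(eq_finite_set (inj_card_eq inj)).
apply: (@sub_finite_set _ _ [set` generation G n]) => // _ [p pp <-] /=.
by rewrite generation_paths; exists p; rewrite size_tuple.
Qed.

Definition labels (T : Type) (X : G -> T -> R) (p : n.-tuple G) (t : T) :
  n.-tuple R := map_tuple (X ^~ t) p.

Lemma path_eventE (T : Type) (X : G -> T -> R) (B : set (n.-tuple R)) :
  path_event X B = \bigcup_(p in kid_paths) (labels X p @^-1` B).
Proof.
have eqX p t : [tuple X (tnth p i) t | i < n] = labels X p t.
  by apply: eq_from_tnth => i; rewrite tnth_mktuple tnth_map.
apply/seteqP; split=> t [p].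
  move=> [pp up Bp]; exists p; last by rewrite /preimage /= -eqX.
  by rewrite /kid_paths /= -simple_path_kid pp.
rewrite /kid_paths /= -simple_path_kid -eqX => /andP[pp up] Bp.
by exists p.
Qed.

Context d (T : measurableType d) (P : probability T R) (X : G -> {RV P >-> R}).

Lemma measurable_labels p : measurable_fun setT (labels X p).
Proof.
apply/measurable_fun_tnthP => i.
rewrite (_ : _ \o _ = X (tnth p i)); first exact: measurable_funPT.
by apply/funext => t; rewrite /= tnth_map.
Qed.

Lemma measurable_path_event (B : set (n.-tuple R)) :
  measurable B -> measurable (path_event X B).
Proof.
move=> mB; rewrite path_eventE; apply: fin_bigcup_measurable => [|p _].
  exact: finite_kid_paths.
by rewrite -[X in measurable X]setTI; exact: measurable_labels.
Qed.

(** Union bound: [mu] is the sum of the laws of the labels along the finitely many paths. It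
    transfers approximation of Borel sets to path events. *)
Lemma path_event_bound : exists mu : {measure set (n.-tuple R) -> \bar R},
  (mu setT < +oo)%E /\
  forall B, measurable B -> (P (path_event X B) <= mu B)%E.
Proof.
pose S := enum_fset (fset_set kid_paths).
(* The default tuple is never reached, since only indices [k < size S] are summed. *)
pose nu k := distribution P (mfun_Sub (mem_set
  (measurable_labels (nth (nseq_tuple n root) S k)))).
exists (msum nu (size S)); split.
  rewrite /= /msum; apply: lte_sum_pinfty => k _.
  have nuT : nu k setT = 1%E by exact: probability_setT.
  by move: (ltry 1 : (1 < +oo :> \bar R)%E); rewrite -nuT.
move=> B mB; rewrite /= /msum path_eventE.
have mp p : measurable (labels X p @^-1` B).
  by rewrite -[X in measurable X]setTI; exact: measurable_labels.
have sub : (P (\bigcup_(p in kid_paths) (labels X p @^-1` B)) <=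
    \sum_(p \in kid_paths) P (labels X p @^-1` B))%E.
  apply: content_sub_fsum => //; first exact: finite_kid_paths.
  by apply: fin_bigcup_measurable => //; exact: finite_kid_paths.
apply: le_trans sub _.
rewrite fsbig_finite ?(big_nth (nseq_tuple n root)) ?big_mkord //.
exact: finite_kid_paths.
Qed.

Lemma path_event_approx (B C : set (n.-tuple R)) :
  measurable B -> measurable C ->
  (P (path_event X B) <= P (path_event X C) + P (path_event X (B `+` C)))%E.
Proof.
move=> mB mC; have mY := measurableY mB mC.
apply: le_trans (measureU2 _ (measurable_path_event mC) (measurable_path_event mY)).
apply: le_measure; rewrite ?inE.
- exact: measurable_path_event.
- by apply: measurableU; exact: measurable_path_event.
rewrite !path_eventE -bigcupU => t [p pp Bt]; exists p => //.
have [Ct|Ct] := pselect (C (labels X p t)); [by left|right].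
by rewrite /preimage setY_def; left.
Qed.

End PathEvent.

Section CylinderPath.
Context (G : rooted_tree) d (T : measurableType d) (R : realType).
Context (P : probability T R) (I : choiceType) (Y : I -> {RV P >-> R}).
Variables (e : G -> I) (K : finType) (c : R -> K) (D : seq K -> bool) (n : nat).
Hypothesis inj_e : injective e.
Hypothesis indepY : mutually_independent Y.
Hypothesis mc : forall j, measurable (c @^-1` [set j]).
Variable p : K -> R.
Hypothesis lawY : forall i j, P (Y i @^-1` (c @^-1` [set j])) = (p j)%:E.

(** The complementary event, that every path fails [D], is the one decided by [miss_tree]. *)
Lemma probability_path_cylinder :
  P (path_event (fun v => Y (e v)) [set x : n.-tuple R | D (map c x)]) =
  (1 - (miss p D n (@tree_root G) [::])%:E)%E.
Proof.
rewrite -(@dt_prob_miss_tree _ _ e).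
rewrite -(probability_dt indepY mc lawY (read_once_miss_tree inj_e D n tree_root [::])).
rewrite -probability_setC; last exact: measurable_dt.
congr (P _); rewrite path_eventE; apply/seteqP; split=> t /=.
  move=> [q pq Dq] /dt_eval_miss_tree /(_ q pq (size_tuple q)) /negP; apply.
  by move: Dq; rewrite /= -map_comp.
move=> nD; apply: contrapT => nq; apply: nD; apply/dt_eval_miss_tree => q pq sq.
apply/negP => Dq; apply: nq; have sq' : size q == n by rewrite sq.
by exists (Tuple sq') => //=; rewrite -map_comp.
Qed.

End CylinderPath.

(** * Larger generations imply domination *)

Section Domination.
Context (R : realType) (G G' : rooted_tree).
Hypothesis symG : spherically_symmetric G.
Hypothesis le_generation :
  forall n, (size (generation G' n) <= size (generation G n))%N.

Lemma spherical_dominates : dominates R G G'.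
Proof.
move=> d T P X X' [indep ident] n B n1 mB.
set Y := fun i : G + G' => _ in indep ident.
pose i0 : G + G' := inl tree_root.
have cyl_le C : cylinder C ->
    (P (path_event (n := n) (fun w => X' w) C) <= P (path_event (fun v => X v) C))%E.
  move=> [K [c [D [mc ->]]]].
  have mYc j : measurable (Y i0 @^-1` (c @^-1` [set j])).
    exact: (measurable_funPTI (Y i0) (mc j)).
  (* The law of a coded label, computed at [i0] and common to all vertices of both trees. *)
  pose p j := fine (P (Y i0 @^-1` (c @^-1` [set j]))).
  have lawY i j : P (Y i @^-1` (c @^-1` [set j])) = (p j)%:E.
    by rewrite /p fineK ?fin_num_measure //; exact: ident.
  have p0 j : 0 <= p j by exact: fine_ge0.
  have p1 : \sum_j p j = 1.
    apply: EFin_inj; rewrite -sumEFin -(probability_setT P).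
    rewrite (measure_partition P (g := c \o Y i0)) //.
    by apply: eq_bigr => j _; rewrite setTI -(lawY i0 j).
  have inj_l : injective (@inl G G') by move=> v w [].
  have inj_r : injective (@inr G G') by move=> v w [].
  rewrite (probability_path_cylinder D n inj_r indep mc lawY).
  rewrite (probability_path_cylinder D n inj_l indep mc lawY).
  by rewrite -!EFinB lee_fin lerD2l lerN2; exact: miss_root.
have [mu [mu_fin mu_le]] := path_event_bound n X.
have [mu' [mu'_fin mu'_le]] := path_event_bound n X'.
apply/lee_addgt0Pr => eps e0.
(* Approximating for the sum of the two bounding measures gives one cylinder that is close to [B]
   for both trees. *)
have [C cC BC] : exists2 C, cylinder C & (measure_add mu mu' (B `+` C) < eps%:E)%E.
  have add_fin : (measure_add mu mu' setT < +oo)%E.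
    by rewrite measure_addE lte_add_pinfty.
  exact: (cylinder_approx add_fin mB e0).
have mC := cylinder_measurable cC; have mY := measurableY mB mC.
apply: le_trans (path_event_approx X' mB mC) _.
(* Pass from [B] to [C] in [G'], compare the trees on [C], and return to [B] in [G]. *)
apply: (@le_trans _ _ (P (path_event (fun v => X v) B) + mu (B `+` C) + mu' (B `+` C))%E).
  apply: leeD; last exact: mu'_le.
  apply: le_trans (cyl_le _ cC) _.
  apply: le_trans (path_event_approx X mC mB) _.
  by rewrite leeD2l // setYC; exact: mu_le.
by rewrite -addeA leeD2l // ltW // -measure_addE.
Qed.

End Domination.

(** * Fair bits *)

Section FairBits.
Variable R : realType.
Local Notation T := (measurableTypeR R).

Definition uniform01 : set T -> \bar R :=
  mrestr (@lebesgue_measure R) (measurable_itv `[0%R, 1%R[).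

HB.instance Definition _ := Measure.on uniform01.

Lemma uniform01_setT : uniform01 setT = 1%E.
Proof.
by rewrite /uniform01 /mrestr setTI lebesgue_measure_itv /= lte01 oppr0 adde0.
Qed.

HB.instance Definition _ := Measure_isProbability.Build _ _ _ uniform01 uniform01_setT.

Definition dyadic m k : set T := [set x : R | k%:R <= x * 2 ^+ m < k.+1%:R].

Lemma dyadic_itv m k : dyadic m k = [set` `[k%:R / 2 ^+ m, k.+1%:R / 2 ^+ m[ ].
Proof.
apply/seteqP; split=> x; rewrite /dyadic /= in_itv /=;
  by rewrite ler_pdivrMr ?ltr_pdivlMr ?exprn_gt0.
Qed.

Lemma measurable_dyadic m k : measurable (dyadic m k).
Proof. by rewrite dyadic_itv; exact: measurable_itv. Qed.

Lemma dyadic_inj m k k' x : dyadic m k x -> dyadic m k' x -> k = k'.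
Proof.
move=> /andP[kx xk] /andP[k'x xk']; apply/eqP.
rewrite eqn_leq; apply/andP; split; rewrite -ltnS -(ltr_nat R).
  exact: le_lt_trans kx xk'.
exact: le_lt_trans k'x xk.
Qed.

Lemma dyadic_split m k x :
  dyadic m k x <-> dyadic m.+1 k.*2 x \/ dyadic m.+1 k.*2.+1 x.
Proof.
rewrite /dyadic /= exprS mulrCA -!addnn !mulrSr !natrD.
move: (x * _) k%:R => y r; split.
  move=> /andP[ky yk].
  have [lt|ge] := ltP (2 * y) (r + r + 1); [left|right];
    by apply/andP; split; lra.
by move=> [|] /andP[ky yk]; apply/andP; split; lra.
Qed.

Lemma uniform01_dyadic m k : (k < 2 ^ m)%N -> uniform01 (dyadic m k) = (2^-m)%:E.
Proof.
move=> km; rewrite /uniform01 /mrestr setIidl.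
  rewrite dyadic_itv lebesgue_measure_itv /= lte_fin.
  rewrite ltr_pM2r ?invr_gt0 ?exprn_gt0 // ltr_nat ltnSn -EFinB -mulrBl.
  by rewrite -natrB // subSnn mul1r.
have e0 : 0 < 2 ^+ m :> R by rewrite exprn_gt0.
move=> x /andP[kx xk]; rewrite /= in_itv /=; apply/andP; split.
  by rewrite -(pmulr_lge0 _ e0); apply: le_trans kx.
rewrite -(ltr_pM2r e0) mul1r; apply: lt_le_trans xk _.
by rewrite -natrX ler_nat.
Qed.

(* The nonnegative reals whose [m.+1]-st binary digit is [1]. *)
Definition bit_set m : set T := \bigcup_k dyadic m.+1 k.*2.+1.

Lemma measurable_bit_set m : measurable (bit_set m).
Proof. by apply: bigcup_measurable => k _; exact: measurable_dyadic. Qed.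

Definition bit m : {RV uniform01 >-> R} := indic_mfun _ (measurable_bit_set m).

Lemma bitE m k x (b : bool) : dyadic m.+1 (b + k.*2) x -> bit m x = b%:R.
Proof.
move=> xk; rewrite /bit /indic; congr (_%:R); congr nat_of_bool.
case: b xk => xk; first by apply: mem_set; exists k.
apply/negbTE; rewrite notin_setE => -[k' _ xk'].
by have := congr1 odd (dyadic_inj xk xk'); rewrite /= !odd_double.
Qed.

Definition bit_law (A : set R) : R := ((0 \in A)%:R + (1 \in A)%:R) / 2.

(** Induction on the number of bits: [bit m] is constant on each half of the dyadic interval, and
    the induction hypothesis handles the later bits there. *)
Lemma uniform01_bits m l k (A : nat -> set R) :
  (forall i, measurable (A i)) -> (k < 2 ^ m)%N ->
  uniform01 (dyadic m k `&` \bigcap_(i in [set i | m <= i < m + l]%N) (bit i @^-1` A i)) =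
  (2^-m * \prod_(m <= i < m + l) bit_law (A i))%:E.
Proof.
move=> mA; elim: l m k => [|l IH] m k km.
  rewrite addn0 big_geq // mulr1 -(uniform01_dyadic km); congr (uniform01 _).
  rewrite (_ : [set i | _] = set0) ?bigcap_set0 ?setIT //.
  by apply/seteqP; split=> i //= /andP[/leq_ltn_trans h /h]; rewrite ltnn.
pose rest := \bigcap_(i in [set i | m.+1 <= i < m.+1 + l]%N) (bit i @^-1` A i).
have mrest : measurable rest.
  apply: fin_bigcap_measurable => [|i _]; last exact: (measurable_funPTI (bit i)).
  by apply: sub_finite_set (finite_II (m.+1 + l)) => i /= /andP[].
have half (b : bool) : uniform01 (dyadic m.+1 (b + k.*2) `&` (bit m @^-1` A m `&` rest)) =
    ((b%:R \in A m)%:R * (2^-m.+1 * \prod_(m.+1 <= i < m.+1 + l) bit_law (A i)))%:E.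
  rewrite EFinM -(IH m.+1 (b + k.*2)%N); last first.
    rewrite expnS mul2n.
    by case: b; rewrite ?add1n ?add0n -?doubleS ?leq_double ?ltn_double.
  have [bA|bA] := boolP (b%:R \in A m).
    rewrite mul1e; congr (uniform01 _); apply/seteqP; split=> x.
      by move=> [xk [_ xr]].
    by move=> [xk xr]; do 2!split=> //; rewrite /= (bitE xk); exact: set_mem.
  rewrite mul0e (_ : _ `&` _ = set0) ?measure0 //; apply/seteqP; split=> // x.
  by move=> [xk [/= +] _]; rewrite (bitE xk) => /mem_set; rewrite (negbTE bA).
have mhalf (b : bool) : measurable (dyadic m.+1 (b + k.*2) `&` (bit m @^-1` A m `&` rest)).
  apply: measurableI; first exact: measurable_dyadic.
  by apply: measurableI => //; exact: (measurable_funPTI (bit m)).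
rewrite (_ : _ `&` _ = (dyadic m.+1 (false + k.*2) `&` (bit m @^-1` A m `&` rest)) `|`
   (dyadic m.+1 (true + k.*2) `&` (bit m @^-1` A m `&` rest))); last first.
  rewrite -setIUl; congr (_ `&` _).
    by apply/seteqP; split=> x; [move/dyadic_split|move=> ?; apply/dyadic_split].
  apply/seteqP; split=> x.
    move=> xA; split; first by apply: xA; rewrite /= leqnn -addSnnS leq_addr.
    by move=> i /= /andP[mi il]; apply: xA; rewrite /= (ltnW mi) -addSnnS.
  move=> [xm xr] i /= /andP[]; rewrite leq_eqVlt => /orP[/eqP <- //|mi il].
  by apply: xr; rewrite /= mi addSnnS.
rewrite measureU //; last first.
  apply/seteqP; split=> // x [[x0 _] [x1 _]].
  by have := congr1 odd (dyadic_inj x0 x1); rewrite /= odd_double.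
rewrite [X in (X + _)%E](half false) [X in (_ + X)%E](half true) -EFinD.
congr (_%:E).
rewrite [in RHS]big_ltn ?addnS ?ltnS ?leq_addr // addSn /bit_law exprS invfM.
by field.
Qed.

Lemma bit_lawT : bit_law setT = 1.
Proof. by rewrite /bit_law !mem_set //= divff. Qed.

(** Reduces to the consecutive bits below [l], with no constraint on the bits outside the image of
    [s]. *)
Lemma uniform01_bits_seq (I : choiceType) (g : I -> nat) (s : seq I)
    (A : I -> set R) : injective g -> uniq s -> (forall i, measurable (A i)) ->
  uniform01 (\bigcap_(i in [set` s]) (bit (g i) @^-1` A i)) =
  (\prod_(i <- s) bit_law (A i))%:E.
Proof.
move=> inj_g us mA.
(* Equal to [A i] if [m = g i] for some [i] in [s], and to the whole line otherwise. *)
pose A' m : set R := \bigcap_(i in [set` [seq i <- s | g i == m]]) A i.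
have mA' m : measurable (A' m) by apply: fin_bigcap_measurable.
have A'T m : m \notin map g s -> A' m = setT.
  move=> ms; apply/seteqP; split=> // x _ i /=; rewrite mem_filter => /andP[/eqP gi si].
  by move: ms; rewrite -gi map_f.
have A'g i : i \in s -> A' (g i) = A i.
  move=> si; apply/seteqP; split=> x; first by apply; rewrite /= mem_filter eqxx.
  by move=> Ax j /=; rewrite mem_filter => /andP[/eqP /inj_g ->].
pose l := (\max_(i <- s) g i).+1.
have gl i : i \in s -> (g i < l)%N by move=> si; rewrite ltnS leq_bigmax_seq.
have := @uniform01_bits 0 l 0 A' mA' isT; rewrite add0n expr0 invr1 mul1r.
have -> : uniform01 (dyadic 0 0 `&` \bigcap_(m in [set m | 0 <= m < l]%N) (bit m @^-1` A' m)) =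
    uniform01 (\bigcap_(i in [set` s]) (bit (g i) @^-1` A i)).
  have -> : \bigcap_(i in [set` s]) (bit (g i) @^-1` A i) =
      \bigcap_(m in [set m | 0 <= m < l]%N) (bit m @^-1` A' m).
    apply/seteqP; split=> x xA.
      by move=> m _ i /=; rewrite mem_filter => /andP[/eqP <- /xA].
    by move=> i /= si; have := xA (g i) (gl i si); rewrite /= A'g.
  rewrite /uniform01 /mrestr setIAC dyadic_itv expr0 !divr1 -setIA.
  by rewrite [X in X `&` _](_ : _ = `[0%R, 1%R[%classic) // setIA setIid setIC.
move=> ->; congr (_%:E).
transitivity (\prod_(m <- map g s) bit_law (A' m)); last first.
  by rewrite big_map !big_seq; apply: eq_bigr => i si; rewrite A'g.
rewrite (bigID (mem (map g s))) /= [X in _ * X]big1 ?mulr1; last first.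
  by move=> m ms; rewrite A'T // bit_lawT.
rewrite -big_filter; apply: perm_big; apply: uniq_perm.
- by rewrite filter_uniq // iota_uniq.
- by rewrite map_inj_uniq.
- move=> m; rewrite mem_filter andb_idr // mem_index_iota => /mapP[i si ->].
  by rewrite gl.
Qed.

Section IidBits.
Variables (I : choiceType) (g : I -> nat).
Hypothesis inj_g : injective g.

Lemma bit_law_preimage (i : I) (A : set R) :
  measurable A -> uniform01 (bit (g i) @^-1` A) = (bit_law A)%:E.
Proof.
move=> mA; have := @uniform01_bits_seq I g [:: i] (fun=> A) inj_g isT (fun=> mA).
rewrite big_seq1 => <-; congr (uniform01 _).
apply/seteqP; split=> x; first by move=> xA j /=; rewrite inE => /eqP ->.
by apply; rewrite /= inE.
Qed.

Lemma iid_bits : iid (fun i => bit (g i)).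
Proof.
split=> [s A us mA|i j A mA].
  rewrite [LHS](uniform01_bits_seq inj_g us mA) -prodEFin.
  by apply: eq_bigr => i _; rewrite -(bit_law_preimage i).
by rewrite [LHS](bit_law_preimage i mA) [RHS](bit_law_preimage j mA).
Qed.

End IidBits.

End FairBits.

(** * Domination implies larger generations *)

Section Converse.
Context (R : realType).

(** A vertex is coded by its depth and its rank in its finite generation. *)
Lemma rooted_tree_countable (G : rooted_tree) : exists g : G -> nat, injective g.
Proof.
exists (fun v => choice.pickle (depth v, index v (generation G (depth v)))).
move=> v w /(pcan_inj choice.pickleK) [eqd]; rewrite eqd => eqi.
have vin : v \in generation G (depth w) by rewrite mem_generation eqd.
have win : w \in generation G (depth w) by rewrite mem_generation.
by rewrite -(nth_index v vin) eqi nth_index.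
Qed.

(** Turns a test of the last label into the complement of an intersection over a generation, where
    independence yields a power. *)
Lemma path_event_last (G : rooted_tree) (T : Type) (X : G -> T -> R) n (A : set R) :
  path_event X [set x : n.+1.-tuple R | A (tnth x ord_max)] =
  ~` \bigcap_(v in [set` generation G n.+1]) (X v @^-1` ~` A).
Proof.
have lastE (p : n.+1.-tuple G) : tnth p ord_max = last tree_root p.
  by rewrite (tnth_nth tree_root) /= -nth_last size_tuple.
rewrite path_eventE setC_bigcap; apply/seteqP; split=> t.
  move=> [p pp]; rewrite /= tnth_map lastE => Ap.
  have pn : last tree_root p \in generation G n.+1.
    by apply/generation_paths; exists p; rewrite size_tuple.
  by exists (last tree_root p); rewrite // /setC /= notK.
move=> [v /generation_paths[p [pp /eqP sp <-]]] /contrapT Av.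
by exists (Tuple sp) => //=; rewrite tnth_map lastE.
Qed.

Lemma dominates_size_generation (G G' : rooted_tree) n :
  dominates R G G' ->
  (size (generation G' n.+1) <= size (generation G n.+1))%N.
Proof.
have [g inj_g] := rooted_tree_countable G.
have [g' inj_g'] := rooted_tree_countable G'.
(* Even positions label [G] and odd ones [G'], so all labels are distinct bits of one number. *)
pose h (i : G + G') := match i with inl v => (g v).*2 | inr w => (g' w).*2.+1 end.
have inj_h : injective h.
  move=> [v|w] [v'|w'] /= eqh.
  - by congr inl; apply: inj_g; exact: double_inj.
  - by have := congr1 odd eqh; rewrite /= !odd_double.
  - by have := congr1 odd eqh; rewrite /= !odd_double.
  - by congr inr; apply: inj_g'; apply: double_inj; case: eqh.
pose B := [set x : n.+1.-tuple R | [set 1] (tnth x ord_max)].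
have mB : measurable B.
  by rewrite -[X in measurable X]setTI; exact: measurable_tnth.
have inj_l : injective (h \o inl) by move=> v v' /inj_h [].
have inj_r : injective (h \o inr) by move=> w w' /inj_h [].
have prob (H : rooted_tree) (k : H -> nat) : injective k ->
    uniform01 (path_event (fun v => bit R (k v)) B) =
    (1 - 2^-1 ^+ size (generation H n.+1))%:E.
  move=> inj_k; rewrite path_event_last probability_setC; last first.
    apply: fin_bigcap_measurable => // v _; apply: (measurable_funPTI (bit R (k v))).
    exact: measurableC.
  have mC1 : H -> measurable (~` [set 1 : R]) by move=> _; exact: measurableC.
  have bits := uniform01_bits_seq inj_k (generation_uniq H n.+1) mC1.
  rewrite [X in (1 - X)%E]bits.
  rewrite big_const_seq count_predT iter_mulr_1 EFinB; congr (_ - (_ ^+ _)%:E)%E.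
  rewrite /bit_law mem_set /=; last by move=> /esym/eqP; rewrite oner_eq0.
  by rewrite (negbTE (_ : 1 \notin ~` [set 1])) ?addr0 ?div1r // notin_setE; apply.
have iidh : iid (fun i : G + G' =>
    match i with inl v => bit R (h (inl v)) | inr w => bit R (h (inr w)) end).
  suff -> : (fun i : G + G' => match i with
      inl v => bit R (h (inl v)) | inr w => bit R (h (inr w)) end) =
      (fun i => bit R (h i)) by exact: iid_bits.
  by apply/funext => -[].
move=> /(_ _ _ _ _ _ iidh n.+1 B isT mB).
rewrite [leLHS](prob G' _ inj_r) [leRHS](prob G _ inj_l) lee_fin lerD2l lerN2.
by rewrite ler_iXn2l // ?invr_gt0 ?invf_lt1 // ltr1n.
Qed.

End Converse.

Theorem theorem1 (R : realType) (G G' : rooted_tree)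
    (symG : spherically_symmetric G) :
  dominates R G G' <->
  (forall n : nat, (1 <= n)%N -> level G' n #<= level G n).
Proof.
split=> [dom [|n] // _|le_level].
  rewrite !level_generation card_seq_le ?generation_uniq //.
  exact: dominates_size_generation dom.
(* Generation 0 is the root alone in both trees; only positive generations need the hypothesis. *)
apply: spherical_dominates => // -[//|n].
by rewrite -card_seq_le ?generation_uniq // -!level_generation le_level.
Qed.
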